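(* Let $q$ be a prime power and let $s$ and $t$ be integers with $2\leq s\leq t$. Then $$\operatorname{ex}_q(M(K_{s,t});n)=O_{q,s,t}\bigl(q^{(1-1/s)n}\bigr);$$ that is, there is a constant $C>0$ depending only on $q,s,t$ such that $\operatorname{ex}_q(M(K_{s,t});n)\leq C\,q^{(1-1/s)n}$ for all positive integers $n$.
   Context: A matroid is simple if it has no loops and no two distinct parallel elements. A matroid is $\operatorname{GF}(q)$-representable if it is isomorphic to the vector matroid of a finite family of vectors over the field with $q$ elements. For matroids $M$ and $N$, $M$ has an $N$-restriction if $M|X\cong N$ for some $X\subseteq E(M)$. $M(G)$ denotes the cycle matroid of a graph $G$, and $K_{s,t}$ is the complete bipartite graph with parts of sizes $s$ and $t$. For a nonempty simple $\operatorname{GF}(q)$-representable matroid $N$, the extremal number $\operatorname{ex}_q(N;n)$ is the maximum number of elements in a rank-$n$ simple $\operatorname{GF}(q)$-representable matroid with no $N$-restriction. *)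

(* Defs.v *)
From HB Require Import structures.
From mathcomp Require Import all_boot all_order all_algebra.
From mathcomp Require Import boolp.
From mathcomp Require classical_sets.

Set Implicit Arguments.
Unset Strict Implicit.
Unset Printing Implicit Defensive.

Import GRing.Theory.

(* The ground set of a matroid is the whole finite type it is indexed by. *)
Record matroid (T : finType) := Matroid {
  indep : pred {set T};
  indep0 : indep set0;
  indepS : forall A B : {set T}, A \subset B -> indep B -> indep A;
  indep_aug : forall A B : {set T}, indep A -> indep B -> #|A| < #|B| ->
    exists2 b, b \in B :\: A & indep (b |: A) }.

Section MatroidNotions.
Variables (T : finType) (M : matroid T).

Definition mrank : nat := \max_(A : {set T} | indep M A) #|A|.

Definition circuit (C : {set T}) : bool :=
  minset (fun A : {set T} => ~~ indep M A) C.

Definition loop (x : T) : bool := circuit [set x].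

Definition parallel (x y : T) : bool := circuit [set x; y].

Definition simple_matroid : Prop :=
  (forall x, ~~ loop x) /\ (forall x y, x != y -> ~~ parallel x y).

Section Restriction.
Variable X : {set T}.

Definition restr_indep (A : {set {x : T | x \in X}}) : bool :=
  indep M (val @: A).

Lemma restr_indep0 : restr_indep set0.
Proof. by rewrite /restr_indep imset0 indep0. Qed.

Lemma restr_indepS (A B : {set {x : T | x \in X}}) :
  A \subset B -> restr_indep B -> restr_indep A.
Proof. by move=> sAB; apply: indepS; apply: imsetS. Qed.

Lemma restr_indep_aug (A B : {set {x : T | x \in X}}) :
  restr_indep A -> restr_indep B -> #|A| < #|B| ->
  exists2 b, b \in B :\: A & restr_indep (b |: A).
Proof.
move=> iA iB ltAB; have := indep_aug iA iB.
rewrite !card_imset; try exact: val_inj.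
case=> // _ /setDP[/imsetP[b bB ->] bA] ib; exists b.
  by rewrite inE bB andbT; apply: contra bA; apply: imset_f.
by rewrite /restr_indep imsetU1.
Qed.

Definition restriction : matroid {x : T | x \in X} :=
  Matroid restr_indep0 restr_indepS restr_indep_aug.
End Restriction.

End MatroidNotions.

Definition matroid_iso (T1 T2 : finType) (M1 : matroid T1) (M2 : matroid T2) :
  Prop :=
  exists2 f : T1 -> T2, bijective f &
    forall A : {set T1}, indep M2 (f @: A) = indep M1 A.

Definition has_restriction (T TN : finType) (M : matroid T) (N : matroid TN) :
  Prop :=
  exists X : {set T}, matroid_iso (restriction M X) N.

Section VectorMatroid.
Local Open Scope ring_scope.
Variables (F : fieldType) (V : vectType F) (I : finType) (v : I -> V).

(* [free] is a condition on a sequence with multiplicities, so two indices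
   carrying the same vector form a dependent set. *)
Definition vec_indep (A : {set I}) : bool := free [seq v i | i <- enum A].

Lemma vec_indepU1 (A : {set I}) (b : I) : b \notin A ->
  vec_indep (b |: A) =
  (v b \notin <<[seq v i | i <- enum A]>>%VS) && vec_indep A.
Proof.
move=> bA; rewrite /vec_indep -free_cons -map_cons.
apply/perm_free/perm_map/uniq_perm; rewrite ?enum_uniq //=.
  by rewrite mem_enum bA enum_uniq.
by move=> z; rewrite mem_enum !inE mem_enum.
Qed.

Lemma vec_indep0 : vec_indep set0.
Proof. by rewrite /vec_indep enum_set0 nil_free. Qed.

Lemma vec_indepS (A B : {set I}) : A \subset B -> vec_indep B -> vec_indep A.
Proof.
move=> sAB; rewrite /vec_indep.
suff /(perm_map v)/perm_free -> : perm_eq (enum B) (enum A ++ enum (B :\: A)).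
  by rewrite map_cat; apply: catl_free.
apply: uniq_perm; rewrite ?enum_uniq //.
  rewrite cat_uniq !enum_uniq andbT /=; apply/hasPn => z.
  by rewrite !mem_enum inE => /andP[].
move=> z; rewrite mem_cat !mem_enum inE.
by have /(_ z) := subsetP sAB; case: (z \in A) => // ->.
Qed.

Lemma vec_indep_aug (A B : {set I}) :
  vec_indep A -> vec_indep B -> (#|A| < #|B|)%N ->
  exists2 b, b \in B :\: A & vec_indep (b |: A).
Proof.
move=> iA iB ltAB; set U := <<[seq v i | i <- enum A]>>%VS.
have [/exists_inP[b bB bU]|/exists_inPn nB] :=
    boolP [exists b in B, v b \notin U].
  have bA : b \notin A.
    by apply: contra bU => bA; apply/memv_span/map_f; rewrite mem_enum.
  by exists b; rewrite ?inE ?bA // vec_indepU1 // bU.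
suff /dimvS : (<<[seq v i | i <- enum B]>> <= U)%VS.
  rewrite (eqP iB) (eqP iA) !size_map -!cardE => le.
  by move: ltAB; rewrite ltnNge le.
apply/span_subvP => _ /mapP[b bB ->].
by have := nB b; rewrite negbK; apply; rewrite -mem_enum.
Qed.

Lemma vec_indep_imset (J : finType) (f : J -> I) (A : {set J}) : injective f ->
  vec_indep (f @: A) = free [seq v (f j) | j <- enum A].
Proof.
move=> injf; rewrite /vec_indep (map_comp v f); apply/perm_free/perm_map.
apply: uniq_perm; rewrite ?(map_inj_uniq injf) ?enum_uniq // => i.
rewrite mem_enum; apply/imsetP/mapP => -[j jA ->]; exists j => //.
  by rewrite mem_enum.
by rewrite -mem_enum.
Qed.

Definition vector_matroid : matroid I :=
  Matroid vec_indep0 vec_indepS vec_indep_aug.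

End VectorMatroid.

Definition GF_representable (q : nat) (T : finType) (M : matroid T) : Prop :=
  exists (F : finFieldType) (d : nat) (I : finType) (v : I -> 'rV[F]_d),
    #|F| = q /\ matroid_iso M (vector_matroid v).

Record sgraph := SGraph {
  vertex : finType;
  adj : rel vertex;
  adj_sym : symmetric adj;
  adj_irr : irreflexive adj }.

Definition edges (G : sgraph) : {set {set vertex G}} :=
  [set [set p.1; p.2] | p : vertex G * vertex G & adj p.1 p.2].

Definition edge_type (G : sgraph) : finType := {e : {set vertex G} | e \in edges G}.

Definition edge_rel (V : finType) (A : {set {set V}}) : rel V :=
  fun x y => [set x; y] \in A.

(* Edges are never singletons, so a cyclic sequence of at least three distinct
   vertices is exactly a cycle of the graph. *)
Definition forest (V : finType) (A : {set {set V}}) : Prop :=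
  ~ exists2 c : seq V, 2 < size c & ucycle (edge_rel A) c.

(* The matroid axioms for forests are inherited, through [forestE], from the
   linear independence of the incidence vectors over GF(2). *)
Section ForestFree.
Local Open Scope ring_scope.
Variable V : finType.
Implicit Types (A B : {set {set V}}) (x y z : V).

Definition incid (e : {set V}) : {ffun V -> ('F_2)^o} := [ffun x => (x \in e)%:R].

Definition pairs A : Prop := forall e, e \in A -> exists x y, x != y /\ e = [set x; y].

Lemma edge_relC A : symmetric (edge_rel A).
Proof. by move=> x y; rewrite /edge_rel setUC. Qed.

Let F2D (a : 'F_2) : a + a = 0.
Proof. by apply/eqP; rewrite -mulr2n -mulr_natr; case: a => [[|[|]]]. Qed.

Let incid2 x y : x != y -> incid [set x; y] = incid [set x] + incid [set y].
Proof.
move=> xy; apply/ffunP => z; rewrite !ffunE !inE.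
case: (eqVneq z x) => [->|_]; rewrite ?add0r //=.
by rewrite (negPf xy) addr0.
Qed.

Let pathS A B x p :
  path (edge_rel A) x p -> A \subset B -> path (edge_rel B) x p.
Proof. by move=> pA /subsetP sAB; apply: sub_path pA => a b; apply: sAB. Qed.

Lemma forest_sub A B : A \subset B -> forest B -> forest A.
Proof.
move=> sAB fB [c c2 /andP[cc cu]]; apply: fB; exists c => //.
rewrite /ucycle cu andbT; case: c c2 cc cu => // x p _ cA _.
exact: pathS cA sAB.
Qed.

Lemma forest_bridge A x y : forest A -> x != y -> [set x; y] \in A ->
  ~~ connect (edge_rel (A :\ [set x; y])) x y.
Proof.
move=> fA xy eA; apply/connectP => -[p pp].
case: (shortenP pp) => {pp}p' pp up _ yl; apply: fA; exists (x :: p').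
  case: p' pp up yl => [|z [|]] //=; first by move=> _ _ yx; rewrite yx eqxx in xy.
  by rewrite /edge_rel andbT => + _ yz; rewrite -yz !inE eqxx.
rewrite /ucycle up andbT /= rcons_path -yl edge_relC [edge_rel _ _ _]eA andbT.
exact: pathS pp (subD1set _ _).
Qed.

Lemma forest_free A : pairs A -> forest A -> vec_indep incid A.
Proof.
move: {2}#|A| (erefl #|A|) => n; elim: n A => [|n IHn] A cA pA fA.
  by move/eqP: cA; rewrite cards_eq0 => /eqP ->; apply: vec_indep0.
have /card_gt0P[e eA] : (0 < #|A|)%N by rewrite cA.
have [x [y [xy exy]]] := pA _ eA.
rewrite -(setD1K eA) vec_indepU1 ?inE ?eqxx //.
rewrite IHn ?andbT; last first.
- exact: forest_sub (subD1set _ _) fA.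
- by move=> f /setD1P[_ /pA].
- by move: cA; rewrite (cardsD1 e) eA => -[].
rewrite exy in eA *; set B := A :\ _.
have nxy : ~~ connect (edge_rel B) x y by apply: forest_bridge.
pose phi (u : {ffun V -> ('F_2)^o}) := \sum_(z | connect (edge_rel B) x z) u z.
have phi1 z : phi (incid [set z]) = (connect (edge_rel B) x z)%:R.
  rewrite /phi; case: (boolP (connect _ x z)) => cz.
    rewrite (bigD1 z) //= ffunE inE eqxx big1 ?addr0 // => i /andP[_ iz].
    by rewrite ffunE inE (negPf iz).
  apply: big1 => i ci; rewrite ffunE inE; case: eqP => // iz.
  by move: cz; rewrite -iz ci.
have phiD u w : phi (u + w) = phi u + phi w.
  by rewrite /phi -big_split; apply: eq_bigr => z _; rewrite ffunE.
apply/negP => sp; suff : phi (incid [set x; y]) = 0.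
  by rewrite incid2 // phiD !phi1 connect0 (negPf nxy) addr0 => /eqP; rewrite oner_eq0.
rewrite (coord_span sp) /phi.
under eq_bigr => z _ do rewrite sum_ffunE.
rewrite exchange_big big1 //= => i _.
under eq_bigr => z _ do rewrite ffunE.
rewrite -scaler_sumr.
suff -> : \sum_(z | connect (edge_rel B) x z)
   (in_tuple [seq incid j | j <- enum B])`_i z = 0 by rewrite scaler0.
have /mapP[f fB ->] :
    (in_tuple [seq incid j | j <- enum B])`_i \in [seq incid j | j <- enum B].
  by apply: mem_nth; rewrite /= size_map -cardE.
rewrite mem_enum in fB.
have [a [b [ab fab]]] : exists a b, a != b /\ f = [set a; b].
  by move: fB => /setD1P[_ /pA].
rewrite -/(phi (incid f)) fab incid2 // phiD !phi1.
have eBab : edge_rel B a b by rewrite /edge_rel -fab.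
by rewrite (same_connect_r (sym_connect_sym (@edge_relC B)) (connect1 eBab)) F2D.
Qed.

Lemma free_forest A : pairs A -> vec_indep incid A -> forest A.
Proof.
move=> pA iA [[|x [|z p]] // c2 /andP[/= /andP[xz zp] /and3P[xp zNp up]]].
move: zp; rewrite rcons_path => /andP[zp yx]; set y := last z p in yx.
have yp : y \in z :: p by apply: mem_last.
have xy : x != y by apply: contra xp => /eqP ->.
have eA : [set x; y] \in A by rewrite setUC.
have zy : z != y.
  rewrite /y; move: c2 zNp; case: (p) => //= w p' _.
  by apply: contra => /eqP ->; apply: mem_last.
set B := A :\ [set x; y].
have incB a b : a != b -> edge_rel B a b ->
    incid [set a] + incid [set b] \in <<[seq incid j | j <- enum B]>>%VS.
  by move=> ab Bab; rewrite -incid2 //; apply/memv_span/map_f; rewrite mem_enum.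
have /negP[] : incid [set x; y] \notin <<[seq incid j | j <- enum B]>>%VS.
  by move: iA; rewrite -(setD1K eA) vec_indepU1 ?inE ?eqxx // => /andP[].
have addK u w t : (u + w) + (w + t) = u + t :> {ffun V -> ('F_2)^o}.
  rewrite -!addrA; congr (_ + _); rewrite addrA -[RHS]add0r; congr (_ + _).
  by apply/ffunP => i; rewrite !ffunE F2D.
have nA a b : edge_rel A a b -> a != b.
  move=> /pA[a' [b' [ab' eab]]]; apply: contra ab' => /eqP ab.
  have : a' \in [set a; b] by rewrite eab !inE eqxx.
  have : b' \in [set a; b] by rewrite eab !inE eqxx orbT.
  by rewrite ab setUid !inE => /eqP -> /eqP ->.
rewrite incid2 // -(addK _ (incid [set z])) rpredD //.
  apply: incB; first exact: nA.
  rewrite /edge_rel !inE [_ \in A]xz andbT; apply: contraNneq zy => e.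
  have : z \in [set x; y] by rewrite -e !inE eqxx orbT.
  rewrite !inE => /orP[/eqP zx|//].
  by move: xp; rewrite -zx inE eqxx.
have sB a b : a != x -> b != x -> edge_rel A a b -> edge_rel B a b.
  move=> ax bx ab; rewrite /edge_rel !inE [_ \in A]ab andbT; apply/eqP => e.
  have : x \in [set a; b] by rewrite e !inE eqxx.
  by rewrite !inE ![x == _]eq_sym (negPf ax) (negPf bx).
have pB r u : u != x -> x \notin r -> path (edge_rel A) u r ->
    path (edge_rel B) u r.
  elim: r u => //= w r IHr u ux; rewrite inE negb_or eq_sym.
  move=> /andP[wx xr] /andP[uw wr]; rewrite IHr // andbT.
  exact: sB.
have inclast r u : path (edge_rel B) u r ->
    incid [set u] + incid [set last u r] \in
      <<[seq incid j | j <- enum B]>>%VS.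
  elim: r u => [|w r IHr] u /=.
    move=> _; rewrite (_ : _ + _ = 0) ?mem0v //.
    by apply/ffunP => i; rewrite !ffunE F2D.
  move=> /andP[uw wr]; rewrite -(addK _ (incid [set w])) rpredD ?IHr //.
  by apply: incB => //; apply: nA; move: uw; rewrite /edge_rel inE => /andP[].
move: xp; rewrite inE negb_or eq_sym => /andP[zx xp].
exact/inclast/pB.
Qed.

Lemma forestE A : pairs A -> forest A <-> vec_indep incid A.
Proof. by move=> pA; split; [apply: forest_free | apply: free_forest]. Qed.

End ForestFree.

Section CycleMatroid.
Variable G : sgraph.
Implicit Types A B : {set edge_type G}.

Definition cycle_indep A : bool := `[< forest (val @: A) >].

Lemma cycle_indepE A : cycle_indep A = vec_indep (fun e => incid (val e)) A.
Proof.
have pA : pairs (val @: A).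
  move=> _ /imsetP[[e eG] _ ->] /=; have /imsetP[[x y] xy ->] := eG.
  exists x, y; split=> //; apply: contraTneq xy => ->.
  by rewrite inE /= adj_irr.
rewrite /vec_indep -(vec_indep_imset (@incid _) _ val_inj).
by apply/asboolP/idP => /(forestE pA).
Qed.

Lemma cycle_indep0 : cycle_indep set0.
Proof. by rewrite cycle_indepE vec_indep0. Qed.

Lemma cycle_indepS A B : A \subset B -> cycle_indep B -> cycle_indep A.
Proof. by rewrite !cycle_indepE; apply: vec_indepS. Qed.

Lemma cycle_indep_aug A B : cycle_indep A -> cycle_indep B -> #|A| < #|B| ->
  exists2 b, b \in B :\: A & cycle_indep (b |: A).
Proof.
rewrite !cycle_indepE => iA iB ltAB.
have [b bBA ib] := vec_indep_aug iA iB ltAB.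
by exists b => //; rewrite cycle_indepE.
Qed.

Definition cycle_matroid : matroid (edge_type G) :=
  Matroid cycle_indep0 cycle_indepS cycle_indep_aug.

End CycleMatroid.

Section CompleteBipartite.
Variables s t : nat.

Definition biclique_adj : rel ('I_s + 'I_t)%type := fun x y =>
  match x, y with inl _, inr _ | inr _, inl _ => true | _, _ => false end.

Lemma biclique_adj_sym : symmetric biclique_adj.
Proof. by move=> [x|x] [y|y]. Qed.

Lemma biclique_adj_irr : irreflexive biclique_adj.
Proof. by move=> [x|x]. Qed.

Definition biclique : sgraph := SGraph biclique_adj_sym biclique_adj_irr.

End CompleteBipartite.

Definition prime_power (q : nat) : Prop :=
  exists p k, [/\ prime p, 0 < k & q = p ^ k].

Definition N_free_size (q : nat) (TN : finType) (N : matroid TN) (n m : nat) :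
  Prop :=
  exists (T : finType) (M : matroid T),
    [/\ #|T| = m, mrank M = n, simple_matroid M, GF_representable q M
      & ~ has_restriction M N].

(* The value is a genuine maximum whenever some matroid qualifies, by
   [extremalP]; if none does, it is 0. *)
Definition extremal (q : nat) (TN : finType) (N : matroid TN) (n : nat) : nat :=
  classical_sets.xget 0 (fun m =>
    N_free_size q N n m /\ forall m', N_free_size q N n m' -> m' <= m).

Lemma simple_GF_bound (q : nat) (T : finType) (M : matroid T) :
  simple_matroid M -> GF_representable q M -> #|T| <= q ^ mrank M.
Proof.
move=> [noloop nopar] [F [d [I [v [cF [f bf iM]]]]]].
have injf : injective f by apply: bij_inj.
pose h x := v (f x); have iE A : indep M A = vec_indep h A.
  by rewrite -iM /= vec_indep_imset.
have sing x : indep M [set x].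
  apply: contraT => nx; have /negP[] := noloop x; apply/minsetP; split=> // B nB.
  rewrite subset1 => /orP[/eqP //|/eqP B0].
  by move: nB; rewrite B0 indep0.
have injh : injective h.
  move=> x y hxy; apply/eqP/contraT => xy; have /negP[] := nopar x y xy.
  apply/minsetP; split.
    rewrite iE vec_indepU1 ?inE //= negb_and negbK hxy memv_span //.
    by apply: map_f; rewrite mem_enum inE.
  move=> B nB sB; apply/eqP; rewrite eqEsubset sB /= subUset !sub1set.
  apply/andP; split; apply: contraNT nB => nz.
    apply: indepS (sing y); apply/subsetP => z zB.
    have := subsetP sB z zB; rewrite !inE => /orP[/eqP zx|//].
    by rewrite -zx zB in nz.
  apply: indepS (sing x); apply/subsetP => z zB.
  have := subsetP sB z zB; rewrite !inE => /orP[//|/eqP zy].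
  by rewrite -zy zB in nz.
have [B iB maxB] := @arg_maxnP _ set0 (indep M) (fun A => #|A|) (indep0 M).
have leB : #|B| <= mrank M by apply: (leq_bigmax_cond _ iB).
pose X := [tuple of [seq h x | x <- enum_tuple B]].
have spanX x : (h x \in <<X>>)%VS.
  apply: contraT => nx; have xB : x \notin B.
    by apply: contra nx => xB; apply/memv_span/map_f; rewrite mem_enum.
  have := maxB (x |: B); rewrite iE vec_indepU1 // nx -iE iB cardsU1 xB.
  by move/(_ isT) => /=; rewrite add1n ltnn.
pose g x := [ffun i : 'I_#|B| => coord X i (h x)].
have injg : injective g.
  move=> x y /ffunP gxy; apply: injh.
  rewrite (coord_span (spanX x)) (coord_span (spanX y)).
  by apply: eq_bigr => i _; have := gxy i; rewrite !ffunE => ->.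
have := leq_card g injg; rewrite card_ffun card_ord cF => leT.
apply: leq_trans leT _; apply: leq_pexp2l leB; rewrite -cF.
by apply/card_gt0P; exists 0%R.
Qed.

Lemma extremalP (q : nat) (TN : finType) (N : matroid TN) (n m : nat) :
  N_free_size q N n m ->
  N_free_size q N n (extremal q N n) /\
  forall m', N_free_size q N n m' -> m' <= extremal q N n.
Proof.
move=> Nm; apply: (@classical_sets.xgetPex _ 0 (fun m =>
  N_free_size q N n m /\ forall m', N_free_size q N n m' -> m' <= m)).
have bnd m' : N_free_size q N n m' -> m' <= q ^ n.
  by move=> [T [M [<- <- sM rM _]]]; apply: simple_GF_bound.
have ex_m : exists m', `[< N_free_size q N n m' >] by exists m; apply/asboolP.
have ub m' : `[< N_free_size q N n m' >] -> m' <= q ^ n by move/asboolP/bnd.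
have [k /asboolP Nk maxk] := ex_maxnP ex_m ub.
by exists k; split=> // m' /asboolP/maxk.
Qed.

(* Main.v *)
(* Let E be the set of vectors of the matroid, with |E| much larger than
   q^((1-1/s)n). Double counting the pairs (z, d) with z in E and d an independent
   (s-1)-tuple such that all z + d_i lie in E, as in the Kovari-Sos-Turan
   argument, yields one such d with at least q^(s-1+t) admissible z. Greedily, t
   of them can be chosen so that the d_i and z_j are jointly independent. With
   d_0 = 0, the s t vectors d_i + z_j then represent M(K_{s,t}). Indeed, they are
   differences of the vertex potentials d_i and -z_j, and such a difference is
   spanned by a subfamily exactly when the edges of the subfamily connect its two
   ends. This criterion does not depend on the field, so the representation can
   be compared with the incidence vectors over GF(2). *)
From HB Require Import structures.
Require Import Defs.
From mathcomp Require Import all_boot all_order all_algebra.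
From mathcomp Require Import reals exp boolp zify ring.
From mathcomp Require classical_sets.

Import Order.TTheory GRing.Theory Num.Theory.
Local Open Scope ring_scope.

Set Implicit Arguments.
Unset Strict Implicit.
Unset Printing Implicit Defensive.

(** * Spans of potential differences as graph connectivity *)

Section SpanConnect.
Variables (W J : finType) (x y : J -> W).
Implicit Type A : {set J}.

Definition ends_rel A : rel W := fun a b =>
  [exists j in A, (x j == a) && (y j == b) || (x j == b) && (y j == a)].

Lemma ends_rel_sym A : symmetric (ends_rel A).
Proof. by move=> a b; apply: eq_existsb => j; rewrite orbC. Qed.

Section OverField.
Variables (F : fieldType) (V : vectType F) (pot : W -> V).

(* Prescribing differences rather than values allows the potentials to be
   dependent: only their differences have to be as free as possible. *)
Definition diff_extend := forall g : W -> F,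
  exists phi : 'Hom(V, F^o), forall a b, phi (pot a - pot b) = g a - g b.

Definition pot_diff j := pot (x j) - pot (y j).

Hypothesis pot_extend : diff_extend.

Lemma span_connect A b :
  (pot_diff b \in <<[seq pot_diff j | j <- enum A]>>%VS)
    = connect (ends_rel A) (x b) (y b).
Proof.
set S := span _; apply/idP/idP => [bS|]; last first.
  rewrite /pot_diff; move: (x b) (y b) => a c /connectP[p + ->].
  elim: p a => [|w p IHp] a /=; first by rewrite subrr mem0v.
  case/andP=> /exists_inP[j jA jaw] /IHp wS.
  (* The first edge of the walk contributes a generator up to sign; the rest telescopes. *)
  rewrite -(subrK (pot w) (pot a)) -addrA rpredD //.
  have jS : pot_diff j \in S by apply/memv_span/map_f; rewrite mem_enum.
  case/orP: jaw => /andP[/eqP <- /eqP <-] //.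
  by rewrite -opprB rpredN.
apply: contraT => nc.
(* A functional that is the indicator of the component of [x b] on potentials
   kills every [pot_diff j] with [j] in [A], but not [pot_diff b]. *)
have [phi phiE] := pot_extend (fun a => (connect (ends_rel A) (x b) a)%:R).
have : phi (pot_diff b) = 0.
  suff sub : (S <= lker phi)%VS.
    by apply/eqP; rewrite -memv_ker; apply: subvP bS.
  apply/span_subvP => _ /mapP[j jA ->]; rewrite memv_ker phiE subr_eq0.
  rewrite mem_enum in jA.
  have jE : ends_rel A (x j) (y j).
    by apply/exists_inP; exists j => //; rewrite !eqxx.
  by rewrite (same_connect_r (sym_connect_sym (@ends_rel_sym A)) (connect1 jE)).
by rewrite phiE connect0 (negPf nc) subr0 => /eqP; rewrite oner_eq0.
Qed.

End OverField.

(** Removing one index [b] at a time splits off a span condition, which [span_connect] turns into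
    the same connectivity on both sides. *)
Lemma vec_indep_pot_diff (F1 F2 : fieldType) (V1 : vectType F1)
  (V2 : vectType F2) (pot1 : W -> V1) (pot2 : W -> V2) A :
  diff_extend pot1 -> diff_extend pot2 ->
  vec_indep (pot_diff pot1) A = vec_indep (pot_diff pot2) A.
Proof.
move=> ext1 ext2; have [n] := ubnP #|A|; elim: n A => // n IHn A.
have [->|[b bA]] := set_0Vmem A; first by rewrite !vec_indep0.
rewrite (cardsD1 b) bA => /IHn IHA; rewrite -(setD1K bA).
have {}bA : b \notin A :\ b by rewrite !inE eqxx.
by rewrite !vec_indepU1 // !span_connect // IHA.
Qed.

End SpanConnect.

(** * Potentials with freely prescribable differences *)

Lemma free_extend (F : fieldType) (V : vectType F) k (X : k.-tuple V)
  (c : 'I_k -> F) :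
  free X -> exists phi : 'Hom(V, F^o), forall i, phi (tnth X i) = c i.
Proof.
move=> fX; exists (\sum_(l < k) c l *: linfun (coord X l : V -> F^o)) => i.
have coordE l : coord X l (tnth X i) = (i == l)%:R.
  by rewrite (tnth_nth 0) coord_free.
rewrite sum_lfunE (bigD1 i) //= big1 => [|l li].
  by rewrite addr0 scale_lfunE lfunE /= coordE eqxx /GRing.scale /= mulr1.
by rewrite scale_lfunE lfunE /= coordE eq_sym (negPf li) scaler0.
Qed.

(* The potential of the vertex [inl ord0] is [0], so only [s] vectors are needed
   for the [s.+1] vertices of the first part. *)
Definition biclique_pot (V : zmodType) s t (d : s.-tuple V) (z : t.-tuple V)
    (a : 'I_s.+1 + 'I_t) : V :=
  match a with
  | inl i => if unlift ord0 i is Some k then tnth d k else 0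
  | inr j => - tnth z j
  end.

(** Only differences matter, so [g] may be shifted to vanish at [inl ord0], whose potential is [0];
    freeness provides the other values. *)
Lemma biclique_pot_extend (F : fieldType) (V : vectType F) s t
  (d : s.-tuple V) (z : t.-tuple V) :
  free (d ++ z) -> diff_extend (biclique_pot d z).
Proof.
move=> fdz g; pose c0 := g (inl ord0).
(* The sign is reversed on the second part, whose potentials are [- tnth z j]. *)
pose c (k : 'I_(s + t)) := match split k with
  | inl i => g (inl (lift ord0 i)) - c0 | inr j => c0 - g (inr j) end.
have [phi phiE] := @free_extend _ _ _ [tuple of d ++ z] c fdz.
have phi_pot a : phi (biclique_pot d z a) = g a - c0.
  case: a => [i|j] /=; last first.
    rewrite linearN /=; have := phiE (rshift s j); rewrite tnth_rshift => ->.
    by rewrite /c (unsplitK (inr j)) opprB.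
  case: unliftP => [i' ->|->]; last by rewrite linear0 subrr.
  have := phiE (lshift t i'); rewrite tnth_lshift => ->.
  by rewrite /c (unsplitK (inl i')).
by exists phi => a b; rewrite linearB /= !phi_pot opprB addrA subrK.
Qed.

Section IncidExtend.
Variable W : finType.

Definition ffun_ev (a : W) (u : {ffun W -> ('F_2)^o}) : ('F_2)^o := u a.

Lemma ffun_ev_is_linear a : linear (ffun_ev a).
Proof. by move=> k u v; rewrite /ffun_ev !ffunE. Qed.

HB.instance Definition _ a := GRing.isLinear.Build 'F_2 {ffun W -> ('F_2)^o}
  ('F_2)^o _ (ffun_ev a) (ffun_ev_is_linear a).

(** Incidence vectors of singletons form the standard basis, so even the values can be
    prescribed. *)
Lemma incid_diff_extend : diff_extend (fun a : W => incid [set a]).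
Proof.
move=> g; exists (\sum_w g w *: linfun (ffun_ev w)).
suff phiE a : (\sum_w g w *: linfun (ffun_ev w)) (incid [set a]) = g a.
  by move=> a b; rewrite linearB /= !phiE.
rewrite sum_lfunE (bigD1 a) //= big1 => [|w wa].
  rewrite addr0 scale_lfunE lfunE /= /ffun_ev ffunE set11.
  by rewrite /GRing.scale /= mulr1.
by rewrite scale_lfunE lfunE /= /ffun_ev ffunE inE (negPf wa) scaler0.
Qed.

Lemma incid_pair (a b : W) :
  a != b -> incid [set a; b] = incid [set a] - incid [set b].
Proof.
move=> ab; apply/ffunP => w; rewrite !ffunE !inE oppr_pchar2 ?pchar_Fp //.
by have [->|_] := eqVneq w a; rewrite ?(negPf ab) ?addr0 ?add0r.
Qed.

End IncidExtend.

(** * Counting vectors over a finite field *)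

Lemma leq_exp2rW a b k : (a <= b -> a ^ k <= b ^ k)%N.
Proof. by case: k => // k; rewrite leq_exp2r. Qed.

Lemma card_vspace_leq (F : finFieldType) m (U : {vspace 'rV[F]_m}) :
  (#|[set u | u \in U]| <= #|F| ^ \dim U)%N.
Proof.
pose f u := [ffun i => coord (vbasis U) i u].
rewrite -[X in (_ <= _ ^ X)%N]card_ord -card_ffun.
rewrite -(@card_in_imset _ _ f) ?max_card // => u v.
rewrite !inE => uU vU /ffunP fuv.
rewrite (coord_vbasis uU) (coord_vbasis vU).
by apply: eq_bigr => i _; have := fuv i; rewrite !ffunE => ->.
Qed.

Lemma card_span_leq (F : finFieldType) m (X : seq 'rV[F]_m) :
  (#|[set u | u \in <<X>>%VS]| <= #|F| ^ size X)%N.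
Proof.
apply: leq_trans (card_vspace_leq _) _; apply: leq_pexp2l (dim_span X).
exact: ltnW (card_finNzRing_gt1 F).
Qed.

(** Before each choice the span of the current vectors has fewer than [#|Z|] elements, so some
    element of [Z] lies outside it. *)
Lemma free_greedy (F : finFieldType) m (Z : {set 'rV[F]_m}) d k :
  free d -> (#|F| ^ (size d + k) <= #|Z|)%N ->
  exists2 z : k.-tuple 'rV[F]_m, {subset z <= Z} & free (d ++ z).
Proof.
move=> fd; elim: k => [|k IHk] le; first by exists [tuple]; rewrite ?cats0.
have lt : (#|F| ^ (size d + k) < #|Z|)%N.
  by apply: leq_trans le; rewrite addnS ltn_exp2l ?card_finNzRing_gt1.
have [z zZ fdz] := IHk (ltnW lt).
have /subsetPn[u uZ] : ~~ (Z \subset [set u | u \in <<d ++ z>>%VS]).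
  apply: contraL lt => /subset_leq_card; rewrite -leqNgt => /leq_trans; apply.
  by rewrite -[in leqRHS](size_tuple z) -size_cat card_span_leq.
rewrite inE => uS; exists (rcons_tuple z u).
  by move=> v; rewrite mem_rcons inE => /orP[/eqP ->|/zZ].
by rewrite -rcons_cat (perm_free (permEl (perm_rcons _ _))) free_cons uS.
Qed.

(** A free tuple shorter than [k] spans at most [N] vectors, which leaves at least [#|A| - N] ways
    to extend it within [A]. *)
Lemma card_free_tuple (F : finFieldType) m (A : {set 'rV[F]_m}) k N :
  (#|F| ^ k <= N)%N ->
  ((#|A| - N) ^ k <=
     #|[set d : k.-tuple 'rV[F]_m | all (mem A) d & free d]|)%N.
Proof.
elim: k => [|k IHk] le.
  rewrite expn0; apply/card_gt0P; exists [tuple].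
  by rewrite inE /= nil_free.
have le' : (#|F| ^ k <= N)%N.
  by apply: leq_trans le; rewrite leq_exp2l ?card_finNzRing_gt1.
have {}IHk := IHk le'.
set S := [set d | _ & _] in IHk.
pose B (d : k.-tuple 'rV[F]_m) := A :\: [set u | u \in <<d>>%VS].
pose P := [set p | (p.1 \in S) && (p.2 \in B p.1)].
have cP : #|[set cons_tuple p.2 p.1 | p in P]| = #|P|.
  by apply: card_in_imset => -[d u] [d' u'] _ _ [-> /val_inj ->].
have : (#|P| <= #|[set d : k.+1.-tuple 'rV[F]_m | all (mem A) d & free d]|)%N.
  rewrite -cP; apply/subset_leq_card/subsetP => _ /imsetP[[d u] + ->].
  rewrite !inE /= => /andP[/andP[-> fd] /andP[ud uA]].
  by rewrite free_cons ud fd andbT; move: uA => /= ->.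
apply: leq_trans; rewrite expnSr.
have -> : #|P| = (\sum_(d in S) #|B d|)%N.
  rewrite -sum1_card; under [RHS]eq_bigr => d _ do rewrite -sum1_card.
  by rewrite pair_big_dep; apply: eq_bigl => p; rewrite inE.
apply: leq_trans (_ : #|S| * (#|A| - N) <= _)%N.
  by rewrite leq_mul2r IHk orbT.
rewrite -sum_nat_const; apply: leq_sum => d _.
rewrite cardsD leq_sub2l //; apply: leq_trans le'.
apply: leq_trans (subset_leq_card (subsetIr _ _)) _.
by apply: leq_trans (card_span_leq _) _; rewrite size_tuple.
Qed.

Lemma card_all_tuple (T : finType) k (A : {set T}) :
  (#|[set d : k.-tuple T | all (mem A) d]| <= #|A| ^ k)%N.
Proof.
rewrite -[k in (_ <= _ ^ k)%N]card_ord -card_ffun_on.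
pose f (d : k.-tuple T) := [ffun i => tnth d i].
rewrite -(@card_imset _ _ f) => [|d d' /ffunP fE]; last first.
  by apply: eq_from_tnth => i; have := fE i; rewrite !ffunE.
apply/subset_leq_card/subsetP => _ /imsetP[d + ->]; rewrite inE => /allP dA.
by apply/ffun_onP => i; rewrite ffunE; apply: dA; apply: mem_tnth.
Qed.

(** * Double counting of translates *)

Section Translates.
Variables (F : finFieldType) (m : nat) (E : {set 'rV[F]_m}).

Definition translates (d : seq 'rV[F]_m) : {set 'rV[F]_m} :=
  [set z in E | all (fun u => z + u \in E) d].

(** Pairs [(z, d)] with [d] free and [z], all [z + d_i] in [E] are counted in two ways: each [z] has
    at least [(#|E| - N) ^ k] partners, each [d] at most [K]. *)
Lemma translates_count (U : {vspace 'rV[F]_m}) n k N K :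
  {subset E <= U} -> (\dim U <= n)%N -> (#|F| ^ k <= N)%N ->
  (forall d : k.-tuple 'rV[F]_m, free d -> (#|translates d| <= K)%N) ->
  (#|E| * (#|E| - N) ^ k <= K * (#|F| ^ n) ^ k)%N.
Proof.
move=> EU dU qN trK.
pose A z := +%R z @^-1: E.
pose D z := [set d : k.-tuple 'rV[F]_m | all (mem (A z)) d & free d].
apply: leq_trans (_ : \sum_(z in E) #|D z| <= _)%N.
  rewrite -sum_nat_const; apply: leq_sum => z _.
  apply: leq_trans (card_free_tuple _ qN).
  by rewrite /A card_preimset //; apply: addrI.
pose DU := [set d : k.-tuple 'rV[F]_m | all (mem [set u | u \in U]) d].
under eq_bigr => z _ do rewrite -sum1_card.
rewrite (exchange_big_dep (fun d => (d \in DU) && free d)) /=; last first.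
  (* The entries of [d] are differences of elements of [E], hence lie in [U]. *)
  move=> z d zE; rewrite !inE => /andP[/allP dA ->]; rewrite andbT.
  apply/allP => u /dA; rewrite /= !inE => zuE.
  by rewrite -(addKr z u) rpredD ?rpredN ?EU.
apply: leq_trans (_ : #|DU| * K <= _)%N.
  rewrite -sum_nat_const big_mkcondr /=; apply: leq_sum => d _.
  case: ifP => // fd; rewrite sum1_card; apply: leq_trans (trK d fd).
  apply/subset_leq_card/subsetP => z; rewrite unfold_in [_ \in translates _]inE.
  case/andP=> ->; rewrite inE => /andP[dA _].
  by apply: sub_all dA => u; rewrite /= inE.
rewrite mulnC leq_mul2l; apply/orP; right.
apply: leq_trans (card_all_tuple _ _) _; apply: leq_exp2rW.
apply: leq_trans (card_vspace_leq U) _.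
by apply: leq_pexp2l => //; apply: ltnW (card_finNzRing_gt1 F).
Qed.

End Translates.

(** * Representations and restrictions of matroids *)

Lemma simple_indep2 (T : finType) (M : matroid T) x y :
  simple_matroid M -> indep M [set x; y].
Proof.
move=> [noloop nopar]; apply: contraT => nxy.
have [C cC sC] := @minset_exists _ (fun A : {set T} => ~~ indep M A) _ nxy.
have : (#|C| <= 2)%N.
  apply: leq_trans (subset_leq_card sC) _.
  by rewrite cards2; case: (x != y).
(* The circuit would be a parallel pair, a loop or empty. *)
rewrite leq_eqVlt ltnS leq_eqVlt ltnS leqn0 => /or3P[/eqP C2|/cards1P[z Cz]|].
- have xy : x != y.
    have := subset_leq_card sC.
    by rewrite C2 cards2; case: (x != y).
  have CE : C = [set x; y] by apply/eqP; rewrite eqEcard sC C2 cards2 xy.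
  by have := nopar x y xy; rewrite /parallel /circuit -CE cC.
- by have := noloop z; rewrite /loop /circuit -Cz cC.
- rewrite cards_eq0 => /eqP C0; have /minsetp := cC.
  by rewrite C0 indep0.
Qed.

(** Simplicity makes the vectors distinct. The ambient dimension [m] may exceed the rank, so later
    counts take place inside the span of the vectors. *)
Lemma vec_representation (q : nat) (T : finType) (M : matroid T) :
  simple_matroid M -> GF_representable q M ->
  exists (F : finFieldType) (m : nat) (h : T -> 'rV[F]_m),
    [/\ #|F| = q, injective h, forall A, indep M A = vec_indep h A &
      (\dim <<codom h>> <= mrank M)%N].
Proof.
move=> sM [F [m [I [v [cF [f bf iM]]]]]].
pose h x := v (f x); exists F, m, h.
have iE A : indep M A = vec_indep h A.
  by rewrite -iM /= vec_indep_imset //; apply: bij_inj.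
split=> // [x y hxy|].
  apply/eqP/contraT => xy; have := simple_indep2 x y sM.
  rewrite iE vec_indepU1 ?inE // hxy memv_span //.
  by apply: map_f; rewrite mem_enum inE.
(* A maximum independent set already spans all the vectors. *)
have [B iB maxB] := @arg_maxnP _ set0 (indep M) (fun A => #|A|) (indep0 M).
apply: leq_trans (_ : #|B| <= _)%N; last exact: (leq_bigmax_cond _ iB).
rewrite cardE -(size_map h); apply: leq_trans (dim_span _).
apply/dimvS/span_subvP => _ /codomP[x ->]; apply: contraT => nx.
have xB : x \notin B.
  by apply: contra nx => xB; apply/memv_span/map_f; rewrite mem_enum.
have := maxB (x |: B); rewrite iE vec_indepU1 // nx -iE iB cardsU1 xB.
by move/(_ isT) => /=; rewrite add1n ltnn.
Qed.

Lemma has_restriction_param (T TN J : finType) (M : matroid T) (N : matroid TN)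
  (phi : J -> T) (psi : J -> TN) : injective phi -> bijective psi ->
  (forall A : {set J}, indep M (phi @: A) = indep N (psi @: A)) ->
  has_restriction M N.
Proof.
move=> injphi [psi' psiK psi'K] iMN; exists (phi @: setT).
have phiX j : phi j \in phi @: setT by apply: imset_f.
pose g e : {x | x \in phi @: setT} := Sub (phi (psi' e)) (phiX (psi' e)).
have injg : injective g.
  by move=> e e' [/injphi] /(can_inj psi'K).
have bg : bijective g.
  apply: inj_card_bij injg _.
  rewrite card_sig -(bij_eq_card (Bijective psiK psi'K)).
  by rewrite -cardsT -(card_imset setT injphi).
case: bg => f gK fK; exists f; first by exists g.
move=> A; rewrite /= /restr_indep.
have -> : val @: A = phi @: (psi' @: (f @: A)).
  by rewrite -!imset_comp; apply: eq_imset => x /=; rewrite -{1}(fK x).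
rewrite iMN -imset_comp (eq_imset (g := id)) ?imset_id //; exact: psi'K.
Qed.

(** * Edges of the complete bipartite graph *)

Section BicliqueEdge.
Variables s t : nat.

Lemma biclique_edge_mem (p : 'I_s * 'I_t) :
  [set inl p.1; inr p.2] \in edges (biclique s t).
Proof. by apply/imsetP; exists (inl p.1, inr p.2); rewrite ?inE. Qed.

Definition biclique_edge p : edge_type (biclique s t) :=
  Sub [set inl p.1; inr p.2] (biclique_edge_mem p).

Lemma biclique_edge_bij : bijective biclique_edge.
Proof.
have inj : injective biclique_edge.
  move=> [i j] [i' j'] [/setP e]; have := e (inl i); have := e (inr j).
  rewrite !inE !eqxx /= ?orbF.
  by move=> /esym/eqP[->] /esym/eqP[->].
apply: (inj_card_bij inj); rewrite -(card_codom inj).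
apply/subset_leq_card/subsetP => -[e eG] _; apply/codomP.
have /imsetP[[a b] ab eab] := eG.
have [[i j] eij] : exists p : 'I_s * 'I_t, e = [set inl p.1; inr p.2].
  case: a b ab eab => a [] b //=; rewrite inE //= => _ ->.
    by exists (a, b).
  by exists (b, a); rewrite setUC.
by exists (i, j); apply: val_inj.
Qed.

End BicliqueEdge.

(** * The forced restriction and the extremal bound *)

Lemma rich_translates (F : finFieldType) m (E : {set 'rV[F]_m})
  (U : {vspace 'rV[F]_m}) n s t :
  {subset E <= U} -> (\dim U <= n)%N ->
  ((2 * #|F| ^ (s + t)) ^ s.+1 * (#|F| ^ n) ^ s < #|E| ^ s.+1)%N ->
  exists2 d : s.-tuple 'rV[F]_m, free d &
    (#|F| ^ (s + t) <= #|translates E d|)%N.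
Proof.
move=> EU dU big; set q := #|F| in big *; have q0 : (0 < q)%N.
  exact: ltnW (card_finNzRing_gt1 F).
apply: contrapT => no; move: big; rewrite ltnNge => /negP; apply.
have qst : (q ^ s <= q ^ (s + t))%N by rewrite leq_pexp2l ?leq_addr.
(* A small [E] satisfies the bound at once; for a large one [#|E| <= 2 * (#|E| - q ^ s)], the source
   of the factor 2. *)
have [small|large] := leqP #|E| (2 * q ^ s).
  apply: leq_trans (leq_pmulr _ _); last by rewrite !expn_gt0 q0.
  by rewrite leq_exp2rW // (leq_trans small) // leq_mul2l qst orbT.
have trK (d : s.-tuple 'rV[F]_m) : free d ->
    (#|translates E d| <= q ^ (s + t))%N.
  by move=> fd; rewrite leqNgt; apply/negP => /ltnW le; apply: no; exists d.
(* [q ^ s] bounds the span of an [s]-tuple; [q ^ (s + t)] is what the greedy choice of [t] more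
   vectors requires. *)
have cnt := translates_count EU dU (leqnn (q ^ s)) trK.
apply: leq_trans (_ : 2 ^ s * (q ^ (s + t) * (q ^ n) ^ s) <= _)%N.
  apply: leq_trans (_ : 2 ^ s * (#|E| * (#|E| - q ^ s) ^ s) <= _)%N.
    rewrite expnS mulnCA leq_mul2l -expnMn leq_exp2rW ?orbT //.
    lia.
  by rewrite leq_mul2l cnt orbT.
rewrite mulnA leq_mul2r; apply/orP; right.
rewrite expnMn; apply: leq_mul; first by rewrite leq_pexp2l.
by rewrite -[leqLHS]expn1 leq_pexp2l // expn_gt0 q0.
Qed.

Lemma biclique_restriction q s t (T : finType) (M : matroid T) :
  simple_matroid M -> GF_representable q M ->
  ((2 * q ^ (s + t)) ^ s.+1 * (q ^ mrank M) ^ s < #|T| ^ s.+1)%N ->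
  has_restriction M (cycle_matroid (biclique s.+1 t)).
Proof.
move=> sM rM big.
have [F [m [h [cF injh iM dimh]]]] := vec_representation sM rM.
pose E := [set h x | x : T].
have EU : {subset E <= <<codom h>>%VS}.
  by move=> _ /imsetP[x _ ->]; apply/memv_span/codom_f.
have cE : #|E| = #|T| by rewrite card_imset.
have [d fd dE] : exists2 d : s.-tuple 'rV[F]_m, free d &
    (#|F| ^ (s + t) <= #|translates E d|)%N.
  by apply: rich_translates EU dimh _; rewrite cF cE.
have [z zE fdz] : exists2 z : t.-tuple 'rV[F]_m,
    {subset z <= translates E d} & free (d ++ z).
  by apply: free_greedy; rewrite ?size_tuple.
pose pot := biclique_pot d z.
have ext : diff_extend pot := biclique_pot_extend fdz.
pose ends1 (p : 'I_s.+1 * 'I_t) : 'I_s.+1 + 'I_t := inl p.1.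
pose ends2 (p : 'I_s.+1 * 'I_t) : 'I_s.+1 + 'I_t := inr p.2.
(* The vector of an edge is [z_j], or [z_j + d_k]; both lie in [E] because [z_j] is in
   [translates E d]. *)
have potE p : exists x, h x == pot_diff ends1 ends2 pot p.
  have /zE := mem_tnth p.2 z; rewrite inE => /andP[zpE /allP dzE].
  suff /imsetP[x _ ->] : pot_diff ends1 ends2 pot p \in E by exists x.
  rewrite /pot_diff /= opprK addrC; case: unliftP => [k _|_].
    by apply: dzE; apply: mem_tnth.
  by rewrite addr0.
pose phi p := xchoose (potE p).
have phiE p : h (phi p) = pot_diff ends1 ends2 pot p.
  exact/eqP/(xchooseP (potE p)).
have injphi : injective phi.
  move=> p p' /(congr1 h); rewrite !phiE => pp'.
  have gE g : g (inl p.1) - g (inr p.2) = g (inl p'.1) - g (inr p'.2) :> F.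
    have [psi psiE] := ext g.
    by rewrite -!psiE -/(pot_diff ends1 ends2 pot p) pp'.
  (* The indicators of the two ends of [p] show that [p'] has the same ends. *)
  have := gE (fun a => (a == inl p.1)%:R).
  have := gE (fun a => (a == inr p.2)%:R).
  rewrite !eqxx /= !subr0 !sub0r => /oppr_inj.
  have eq1 (b : bool) : 1%:R = b%:R :> F -> b.
    by case: b => // /eqP; rewrite oner_eq0.
  move=> /eq1/eqP[e2] /eq1/eqP[e1].
  by rewrite [p]surjective_pairing [p']surjective_pairing e1 e2.
apply: (has_restriction_param injphi (biclique_edge_bij s.+1 t)) => A.
rewrite iM /= cycle_indepE !vec_indep_imset //; last first.
  exact: bij_inj (biclique_edge_bij _ _).
transitivity (vec_indep (pot_diff ends1 ends2 pot) A).
  by congr free; apply: eq_map => p; apply: phiE.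
(* Over GF(2), where signs vanish, the same differences are the incidence vectors of the edges. *)
rewrite (vec_indep_pot_diff _ _ _ ext (@incid_diff_extend _)).
by congr free; apply: eq_map => p; rewrite /= incid_pair.
Qed.

Theorem theorem1p7 (R : realType) (q s t : nat) (hq : prime_power q)
  (hs : (2 <= s)%N) (hst : (s <= t)%N) :
  exists2 C : R, 0 < C &
    forall n : nat, (0 < n)%N ->
      (extremal q (cycle_matroid (biclique s t)) n)%:R
        <= C * q%:R `^ ((1 - s%:R^-1) * n%:R).
Proof.
have q0 : (0 < q)%N.
  by have [p [k [p_pr _ ->]]] := hq; rewrite expn_gt0 prime_gt0.
(* The first part now has [s.+1] vertices, and the exponent is [s / s.+1] times [n]. *)
case: s hs hst => // s _ _.
(* This is the [s.+1]-th root of the constant factor in [biclique_restriction]. *)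
exists (2 * q ^ (s + t))%:R => [|n _].
  by rewrite ltr0n muln_gt0 expn_gt0 q0.
(* Without a maximum, [extremal] takes its default value [0]. *)
rewrite /extremal; case: classical_sets.xgetP => [e _ [Ne _]|_]; last first.
  by rewrite mulr_ge0 ?powR_ge0 ?ler0n.
have [T [M [cT rkM sM rM nres]]] := Ne.
have bound : (e ^ s.+1 <= (2 * q ^ (s + t)) ^ s.+1 * (q ^ n) ^ s)%N.
  rewrite leqNgt -cT -rkM; apply/negP => big.
  by apply: nres; apply: biclique_restriction big.
set x := q%:R `^ _; have x0 : 0 <= x := powR_ge0 _ _.
(* The power [s.+1] clears the fraction in the exponent, so the comparison can be made in the
   naturals. *)
have xE : x ^+ s.+1 = ((q ^ n) ^ s)%:R.
  rewrite -powR_mulrn // /x -powRrM -expnM natrX -powR_mulrn ?ler0n //.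
  congr (_ `^ _); rewrite natrM -natr1; field.
  by rewrite natr1 pnatr_eq0.
rewrite -(@ler_pXn2r _ s.+1) ?nnegrE ?mulr_ge0 ?ler0n //.
by rewrite exprMn xE -!natrX -natrM ler_nat.
Qed.
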